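(* Let $W_{1,n}$ ($n\ge 3$) be a wheel graph. Then $$edim(W_{1,n})=\begin{cases} n, & n=3,4,\\ n-1, & n\ge 5.\end{cases}$$
   Context: All graphs are finite and simple. The wheel graph $W_{1,n}$ is the graph obtained from a cycle $C_n$ on $n$ vertices and the trivial graph $K_1$ by adding all the edges between the vertex of $K_1$ and every vertex of $C_n$. For a connected graph $G=(V,E)$, $d_G(x,y)$ is the length of a shortest path between vertices $x,y$. The distance between a vertex $v$ and an edge $e=uw$ is $d_G(e,v)=\min\{d_G(u,v),d_G(w,v)\}$. A vertex $w$ distinguishes two edges $e_1,e_2$ if $d_G(w,e_1)\ne d_G(w,e_2)$. A set $S\subseteq V$ is an edge metric generator for $G$ if every two distinct edges of $G$ are distinguished by some vertex of $S$; the edge metric dimension $edim(G)$ is the smallest cardinality of an edge metric generator for $G$. *)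

(* Defs.v *)
From mathcomp Require Import all_boot.

Set Implicit Arguments.
Unset Strict Implicit.
Unset Printing Implicit Defensive.

Record sgraph := SGraph {
  vertex :> finType;
  adj : rel vertex;
  adj_sym : symmetric adj;
  adj_irr : irreflexive adj
}.

Definition is_path (G : sgraph) (x y : G) (p : seq G) : bool :=
  [&& path (@adj G) x p, last x p == y & uniq (x :: p)].

(* A path has at most #|G| vertices, hence length < #|G|. The default #|G| is
   reached only when no path joins x to y, so never in a connected graph. *)
Definition dist (G : sgraph) (x y : G) : nat :=
  \big[minn/#|G|]_(k < #|G| | [exists p : k.-tuple G, is_path x y p]) k.

Definition edges (G : sgraph) : {set {set G}} :=
  [set e | [exists u, exists w, adj u w && (e == [set u; w])]].

(* An edge e = {u, w} is nonempty and distances are at most #|G|, so the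
   default #|G| does not affect the minimum of dist u v and dist w v. *)
Definition edge_dist (G : sgraph) (e : {set G}) (v : G) : nat :=
  \big[minn/#|G|]_(u in e) dist u v.

Definition distinguishes (G : sgraph) (w : G) (e1 e2 : {set G}) : bool :=
  edge_dist e1 w != edge_dist e2 w.

Definition edge_metric_generator (G : sgraph) (S : {set G}) : bool :=
  [forall e1 in edges G, forall e2 in edges G,
     (e1 != e2) ==> [exists w in S, distinguishes w e1 e2]].

(* Cardinalities are at most #|G|, and the full vertex set is always an edge
   metric generator: an endpoint of e1 outside e2 is at distance 0 from e1
   and at positive distance from e2. So this is a genuine minimum. *)
Definition edim (G : sgraph) : nat :=
  \big[minn/#|G|]_(S : {set G} | edge_metric_generator S) #|S|.

(* ordS is the cyclic successor i |-> i + 1 mod n. The conjunct i != j only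
   matters for n = 1, where ordS has a fixed point. *)
Definition cycle_adj n : rel 'I_n :=
  fun i j => (i != j) && ((ordS i == j) || (ordS j == i)).

Lemma cycle_adj_sym n : symmetric (@cycle_adj n).
Proof. by move=> i j; rewrite /cycle_adj eq_sym orbC. Qed.

Lemma cycle_adj_irr n : irreflexive (@cycle_adj n).
Proof. by move=> i; rewrite /cycle_adj eqxx. Qed.

Definition cycle_graph n : sgraph :=
  SGraph (@cycle_adj_sym n) (@cycle_adj_irr n).

(* None is the vertex of K_1; Some i are the vertices of the cycle. *)
Definition wheel_adj n : rel (option (cycle_graph n)) :=
  fun x y => match x, y with
             | Some i, Some j => adj i j
             | None, None => false
             | _, _ => true
             end.

Lemma wheel_adj_sym n : symmetric (@wheel_adj n).
Proof. by case=> [i|] [j|] //=; exact: cycle_adj_sym. Qed.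

Lemma wheel_adj_irr n : irreflexive (@wheel_adj n).
Proof. by case=> [i|] //=; exact: cycle_adj_irr. Qed.

Definition wheel n : sgraph := SGraph (@wheel_adj_sym n) (@wheel_adj_irr n).

(* Main.v *)
Require Import Defs.
From mathcomp Require Import all_boot.
From mathcomp Require Import zify.

Set Implicit Arguments.
Unset Strict Implicit.
Unset Printing Implicit Defensive.

(** The wheel has diameter at most 2, so the distance from a vertex w to an
    edge e is 0, 1 or 2, and everything is decided by two yes-no questions:
    is w an endpoint of e ([edge_dist_eq0]), and is w equal or adjacent to an
    endpoint of e, in which case e is said to dominate w ([edge_dist_le1])?
    A spoke dominates every vertex because it contains the hub.  The edge
    joining the rim vertices i and i + 1 dominates, on the rim, exactly the
    window i - 1, i, i + 1, i + 2.  This window is the whole rim when n <= 4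
    and leaves some vertex out when n >= 5; that is where the two cases of the
    theorem come from.

    Lower bound ([generator_card]).  Two spokes dominate every vertex, so only
    their two rim endpoints can distinguish them.  Hence a generator misses at
    most one rim vertex, and has at least n - 1 elements.  Suppose that n <= 4
    and that the rim vertex j is missed.  The spoke at j + 1 and the rim edge
    from j to j + 1 both dominate every vertex, and they differ only in the
    endpoints hub and j.  So the generator contains the hub and again has at
    least n elements.

    Upper bound ([rim_set_generator]).  Take the whole rim if n <= 4, and the
    rim without one vertex j if n >= 5.  Distinct edges e and f have endpoints
    u of e and v of f that do not lie on the other edge, and a chosen one among
    u and v distinguishes e from f.  When neither is chosen, one of them is the
    hub, say u, and the other is j; then e is a spoke, f is a rim edge, and
    since n >= 5 some chosen vertex lies outside the window of f, at distance 1
    from e and 2 from f. *)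

(** * Distances between vertices and edges in a graph *)

(** The starting value d competes in the minimum like the values of F.  The
    minima in [dist], [edge_dist] and [edim] all have this form. *)
Lemma bigminn_leP (T : finType) (P : pred T) (F : T -> nat) (d m : nat) :
  reflect (d <= m \/ exists2 t, P t & F t <= m)
          (\big[minn/d]_(t | P t) F t <= m).
Proof.
apply: (iffP idP) => [|[le_dm | [t Pt le_Ftm]]].
- apply: (big_ind (fun k => k <= m -> d <= m \/ exists2 t, P t & F t <= m)).
  + by left.
  + by move=> x y IHx IHy; rewrite geq_min => /orP[/IHx | /IHy].
  + by move=> t Pt le_Ftm; right; exists t.
- by elim/big_rec: _ => // t k _ le_km; rewrite geq_min le_km orbT.
- have: t \in index_enum T by rewrite mem_index_enum.
  elim: (index_enum T) => // s r IHr; rewrite inE big_cons.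
  case/orP=> [/eqP<- | /IHr le_rm]; first by rewrite Pt geq_min le_Ftm.
  by case: ifP => // _; rewrite geq_min le_rm orbT.
Qed.

Section Graph.

Variable G : sgraph.
Implicit Types (u v w : G) (e f : {set G}).

Lemma edgesP e :
  reflect (exists u, exists2 w, adj u w & e = [set u; w]) (e \in edges G).
Proof.
rewrite inE; apply: (iffP existsP) => [[u /existsP[w /andP[uw /eqP->]]] | [u [w uw ->]]].
  by exists u, w.
by exists u; apply/existsP; exists w; rewrite uw eqxx.
Qed.

Lemma card_edge e : e \in edges G -> #|e| = 2.
Proof.
case/edgesP=> u [w uw ->]; rewrite cards2; case: eqP => // eq_uw.
by rewrite eq_uw adj_irr in uw.
Qed.

Lemma dist_leP u v m :
  m < #|G| -> reflect (exists2 p, size p <= m & is_path u v p) (dist u v <= m).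
Proof.
move=> lt_m; apply: (iffP (bigminn_leP _ _ _ _)) => [[|[k /existsP[p uv] le_km]] | [p le_pm uv]].
- by rewrite leqNgt lt_m.
- by exists p; rewrite ?size_tuple.
- right; exists (Ordinal (leq_ltn_trans le_pm lt_m)) => //=.
  by apply/existsP; exists (in_tuple p).
Qed.

Lemma dist_le0 u v : (dist u v <= 0) = (u == v).
Proof.
have G_gt0 : 0 < #|G| by apply/card_gt0P; exists u.
apply/(dist_leP _ _ G_gt0)/eqP => [[[|//] _ /and3P[_ /eqP]] // | ->].
by exists [::] => //; rewrite /is_path /= eqxx.
Qed.

Lemma dist_le1 u v : 1 < #|G| -> (dist u v <= 1) = (u == v) || adj u v.
Proof.
move=> G_gt1; apply/(dist_leP _ _ G_gt1)/orP => [[[|x [|//]] _] | [/eqP-> | uv]].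
- by case/and3P=> _ /= uv _; left.
- by case/and3P=> /= /andP[ux _] /eqP<- _; right.
- by exists [::] => //; rewrite /is_path /= eqxx.
exists [:: v] => //; rewrite /is_path /= uv eqxx inE !andbT.
by apply: contraTneq uv => ->; rewrite adj_irr.
Qed.

Lemma edge_dist_leP e v m :
  m < #|G| -> reflect (exists2 u, u \in e & dist u v <= m) (edge_dist e v <= m).
Proof.
move=> lt_m; apply: (iffP (bigminn_leP _ _ _ _)) => [[|//] | ]; last by right.
by rewrite leqNgt lt_m.
Qed.

Lemma edge_dist_eq0 e v : (edge_dist e v == 0) = (v \in e).
Proof.
have G_gt0 : 0 < #|G| by apply/card_gt0P; exists v.
rewrite -leqn0; apply/(edge_dist_leP _ _ G_gt0)/idP => [[u ue] | ve].
  by rewrite dist_le0 => /eqP<-.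
by exists v; rewrite ?dist_le0.
Qed.

(** Being dominated by e is being at distance at most 1 from e; the formula
    mentions adjacency only, so that it can be computed. *)
Definition dominates e v := [exists u in e, (u == v) || adj u v].

Lemma edge_dist_le1 e v : 1 < #|G| -> (edge_dist e v <= 1) = dominates e v.
Proof.
move=> G_gt1; apply/(edge_dist_leP _ _ G_gt1)/exists_inP.
all: by case=> u ue uv; exists u; rewrite // ?dist_le1 // -dist_le1.
Qed.

Lemma distinguishes_sym w e f : distinguishes w e f = distinguishes w f e.
Proof. by rewrite /distinguishes eq_sym. Qed.

Lemma distinguishes_endpoint w e f :
  w \in e -> w \notin f -> distinguishes w e f.
Proof.
rewrite -!edge_dist_eq0 /distinguishes => /eqP->.
by rewrite eq_sym.
Qed.

Lemma distinguishes_dominated w e f : 1 < #|G| ->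
  dominates e w -> ~~ dominates f w -> distinguishes w e f.
Proof.
move=> G_gt1; rewrite -!edge_dist_le1 // /distinguishes => le_e.
by apply: contraNneq => <-.
Qed.

Lemma distinguishes_dominatedE w e f : 1 < #|G| ->
  dominates e w -> dominates f w ->
  distinguishes w e f = ((w \in e) != (w \in f)).
Proof.
move=> G_gt1; rewrite -!edge_dist_le1 // -!edge_dist_eq0 /distinguishes.
by case: (edge_dist e w) (edge_dist f w) => [|[|//]] [|[|//]].
Qed.

Lemma edge_metric_generatorP (S : {set G}) :
  reflect (forall e f, e \in edges G -> f \in edges G -> e != f ->
             exists2 w, w \in S & distinguishes w e f)
          (edge_metric_generator S).
Proof.
apply: (iffP forall_inP) => [genS e f eE fE ne_ef | genS e eE].
  by have /forall_inP/(_ f fE)/implyP/(_ ne_ef)/exists_inP := genS e eE.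
by apply/forall_inP=> f fE; apply/implyP=> ne_ef; apply/exists_inP/genS.
Qed.

(** Edges have the same cardinality, so neither of two distinct ones contains
    the other. *)
Lemma edge_diff e f :
  e \in edges G -> f \in edges G -> e != f -> exists2 u, u \in e & u \notin f.
Proof.
move=> eE fE; rewrite eqEcard !card_edge // andbT => /subsetPn[u].
by exists u.
Qed.

(** Since #|S| <= #|G|, the value #|G| at which the minimum in [edim] starts
    does not push it below k. *)
Lemma edim_eq (S : {set G}) k :
    edge_metric_generator S -> #|S| = k ->
    (forall S' : {set G}, edge_metric_generator S' -> k <= #|S'|) ->
  edim G = k.
Proof.
move=> genS cardS minS; apply/eqP; rewrite eqn_leq; apply/andP; split.
  by apply/bigminn_leP; right; exists S; rewrite ?cardS.
rewrite leqNgt -cardS; apply/negP.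
case: #|S| {genS} (max_card S) cardS => // s le_sG eq_sk.
rewrite ltnS => /bigminn_leP[|[S' /minS]]; first by rewrite leqNgt le_sG.
by rewrite -eq_sk ltnNge => /negP.
Qed.

End Graph.

(** * Edges and domination in the wheel *)

Section Wheel.

Variable n : nat.
Implicit Types (i j k : 'I_n).

Definition hub : wheel n := None.
Definition rim i : wheel n := Some i.
Definition spoke i : {set wheel n} := [set hub; rim i].
Definition rim_edge i : {set wheel n} := [set rim i; rim (ordS i)].

Lemma rim_inj : injective rim.
Proof. by move=> i j []. Qed.

Lemma card_wheel : #|wheel n| = n.+1.
Proof. by rewrite card_option card_ord. Qed.

Lemma spoke_edge i : spoke i \in edges (wheel n).
Proof. by apply/edgesP; exists hub, (rim i). Qed.

Lemma dominates_hub (e : {set wheel n}) v : hub \in e -> dominates e v.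
Proof.
by move=> he; apply/exists_inP; exists hub => //; case: v.
Qed.

Lemma ordS_neq i : 1 < n -> ordS i != i.
Proof.
move=> n_gt1; rewrite -val_eqE /=.
have := ltn_ord i; rewrite leq_eqVlt => /orP[/eqP Si | lt_Si].
  by rewrite Si modnn; apply/eqP; lia.
by rewrite modn_small //; apply/eqP; lia.
Qed.

Lemma rim_edge_edge i : 1 < n -> rim_edge i \in edges (wheel n).
Proof.
move=> n_gt1; apply/edgesP; exists (rim i), (rim (ordS i)) => //=.
by rewrite /cycle_adj eqxx andbT eq_sym ordS_neq.
Qed.

Lemma adj_rimP i j : adj (rim i) (rim j) ->
  exists k, [set rim i; rim j] = rim_edge k.
Proof.
case/andP=> _ /orP[] /eqP<-; first by exists i.
by exists j; rewrite setUC.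
Qed.

(** The closed neighbourhood, within the rim, of the edge from i to i + 1.
    A list rather than a set, because its length bounds the number of distinct
    entries by 4 whether or not some of them coincide, as they do for n = 3. *)
Definition window i := [:: ord_pred i; i; ordS i; ordS (ordS i)].

Lemma dominates_rim_edge i v : dominates (rim_edge i) (rim v) = (v \in window i).
Proof.
have eqS i1 i2 : (ordS i1 == i2) = (i1 == ord_pred i2).
  exact: (can2_eq (@ordSK n) (@ord_predK n)).
have -> : dominates (rim_edge i) (rim v) =
    ((i == v) || cycle_adj i v) || ((ordS i == v) || cycle_adj (ordS i) v).
  apply/exists_inP/orP => [[u /set2P[]->] | [] iv]; first by left.
  - by right.
  - by exists (rim i); rewrite ?set21.
  - by exists (rim (ordS i)); rewrite ?set22.
(* Both sides become Boolean combinations of the comparisons of v with the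
   four entries of the window. *)
rewrite /cycle_adj !inE (inj_eq (can_inj (@ordSK n))).
rewrite [v == ord_pred i]eq_sym [v == i]eq_sym [v == ordS i]eq_sym [v == ordS (ordS i)]eq_sym.
rewrite (eqS v) [v == ord_pred i]eq_sym.
by case: (i == v); case: (ordS i == v); case: (ord_pred i == v); case: (_ == v).
Qed.

Lemma window_small i v : 2 < n <= 4 -> v \in window i.
Proof.
move=> n_bds; rewrite !inE -!val_eqE /=.
have [n3 | n4]: n = 3 \/ n = 4 by lia.
all: have := ltn_ord i; have := ltn_ord v; rewrite ?n3 ?n4; lia.
Qed.

Lemma window_large i : 4 < n -> exists v, v \notin window i.
Proof.
move=> n_gt4; apply/existsP; rewrite -negb_forall; apply/negP=> /forallP sub.
have := card_size (window i); rewrite (eq_card sub) card_ord /=; lia.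
Qed.

(** * Sets of rim vertices that are generators *)

Lemma rim_set_generator (A : {set 'I_n}) :
    1 < n -> #|~: A| <= 1 -> 4 < n \/ A = setT ->
  edge_metric_generator (rim @: A).
Proof.
move=> n_gt1 /card_le1_eqP missA n_or_A; have W_gt1 : 1 < #|wheel n|.
  by rewrite card_wheel ltnS ltnW.
have missing i j : i \notin A -> j \notin A -> i = j.
  by move=> iA jA; apply: missA; rewrite inE.
apply/edge_metric_generatorP.
have endpointA i (e f : {set wheel n}) : i \in A -> rim i \in e -> rim i \notin f ->
    exists2 w, w \in rim @: A & distinguishes w e f.
  by move=> iA ie i'f; exists (rim i); rewrite ?imset_f ?distinguishes_endpoint.
have sym (e f : {set wheel n}) : (exists2 w, w \in rim @: A & distinguishes w f e) ->
    exists2 w, w \in rim @: A & distinguishes w e f.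
  by case=> w wA; rewrite distinguishes_sym; exists w.
(* The only delicate pair: e is a spoke and f a rim edge, and the endpoint j
   of f may be the one rim vertex outside A. *)
have hub_case (e f : {set wheel n}) j : e \in edges (wheel n) -> f \in edges (wheel n) ->
    hub \in e -> hub \notin f -> rim j \in f -> rim j \notin e ->
    exists2 w, w \in rim @: A & distinguishes w e f.
  move=> eE fE he h'f jf j'e.
  have [jA | j'A] := boolP (j \in A); first by apply/sym/(endpointA j).
  case: n_or_A => [n_gt4 | A_T]; last by rewrite A_T inE in j'A.
  have [k kf] : exists k, f = rim_edge k.
    case/edgesP: fE h'f => [[u|] [[v|] uv ->]] //; last by rewrite set21.
      by move=> _; apply: adj_rimP uv.
    by rewrite set22.
  have [v v'k] := window_large k n_gt4.
  (* The vertex j belongs to f, hence to the window of f, unlike v; as A misses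
     no rim vertex other than j, it contains v. *)
  have vA : v \in A.
    apply: contraR v'k => v'A; rewrite -dominates_rim_edge -kf (missing v j) //.
    by apply/exists_inP; exists (rim j) => //; rewrite eqxx.
  exists (rim v); first exact: imset_f.
  apply: distinguishes_dominated => //; first exact: dominates_hub.
  by rewrite kf dominates_rim_edge.
move=> e f eE fE ne_ef.
have [[i|] ie i'f] := edge_diff eE fE ne_ef; last first.
  rewrite eq_sym in ne_ef; have [[j|] jf j'e] := edge_diff fE eE ne_ef.
    exact: (hub_case e f j).
  by case/negP: j'e.
rewrite eq_sym in ne_ef; have [[j|] jf j'e] := edge_diff fE eE ne_ef; last first.
  by apply/sym/(hub_case f e i).
have [iA | i'A] := boolP (i \in A); first exact: (endpointA i).
have [jA | j'A] := boolP (j \in A); first by apply/sym/(endpointA j).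
by case/negP: j'e; rewrite (missing j i).
Qed.

(** * Lower bound on the size of a generator *)

Variable S : {set wheel n}.
Hypotheses (n_gt2 : 2 < n) (genS : edge_metric_generator S).

Let missed := [set i | rim i \notin S].

Let W_gt1 : 1 < #|wheel n|.
Proof. by rewrite card_wheel ltnS (ltn_trans _ n_gt2). Qed.

(** If i and j are both missed, then the spokes at i and j have the same
    endpoints in S, and both dominate all of it. *)
Lemma card_missed_le1 : #|missed| <= 1.
Proof.
apply/card_le1_eqP=> i j; rewrite !inE => i'S j'S.
apply: contraNeq i'S => ne_ij.
have [|w wS] := edge_metric_generatorP _ genS _ _ (spoke_edge i) (spoke_edge j).
  apply: contraNneq ne_ij => /setP/(_ (rim i)); rewrite set22 => /esym/set2P[] //.
  by move/rim_inj->.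
rewrite distinguishes_dominatedE ?dominates_hub ?set21 // !inE.
case: (w =P rim i) => [<- // | _]; case: (w =P rim j) => [wj | _]; last by rewrite eqxx.
by rewrite -wj wS in j'S.
Qed.

(** For n <= 4 the rim edge from j to j + 1 dominates every vertex, just as the
    spoke at j + 1 does, so these two edges can be told apart only by j or by
    the hub. *)
Lemma hub_in_generator_of_missed j : n <= 4 -> j \in missed -> hub \in S.
Proof.
move=> n_le4 jM; have n_gt1 : 1 < n by apply: ltn_trans n_gt2.
have [|w wS] := edge_metric_generatorP _ genS _ _
  (spoke_edge (ordS j)) (rim_edge_edge j n_gt1).
  by apply/eqP=> /setP/(_ hub); rewrite set21 !inE.
have [/eqP<- // | w_rim] := boolP (w == hub).
have v'j : w != rim j by apply: contraTneq wS => ->; rewrite inE in jM.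
rewrite distinguishes_dominatedE //.
- by rewrite !inE (negPf w_rim) (negPf v'j) eqxx.
- by rewrite dominates_hub ?set21.
case: w {wS v'j} w_rim => // v _.
by rewrite dominates_rim_edge window_small // n_gt2.
Qed.

(** The Boolean in the sum is 1 when n <= 4: then the generator contains either
    the whole rim or the hub together with all but one rim vertex. *)
Lemma generator_card : n.-1 + (n <= 4) <= #|S|.
Proof.
have cardM : #|missed| + #|~: missed| = n by rewrite cardsC card_ord.
have sub_hub : rim @: (~: missed) \subset S :\ hub.
  by apply/subsetP=> _ /imsetP[i + ->]; rewrite !inE negbK => ->.
have := subset_leq_card sub_hub; rewrite (card_imset _ rim_inj) => le_S.
have := cardsD1 hub S; have := card_missed_le1.
case: (leqP n 4) => [n_le4 | _]; last lia.
have [/eqP | [j jM]] := set_0Vmem missed; first by rewrite -cards_eq0; lia.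
rewrite (hub_in_generator_of_missed n_le4 jM); lia.
Qed.

End Wheel.

Arguments rim {n} i.

(** * The edge metric dimension of the wheel *)

Theorem proposition5 (n : nat) (hn : 3 <= n) :
  edim (wheel n) = if (n == 3) || (n == 4) then n else n.-1.
Proof.
have n_gt1 : 1 < n by apply: ltn_trans hn.
case: ifP => n34.
  apply: (@edim_eq _ (rim @: [set: 'I_n])) => [||S genS].
  - by apply: rim_set_generator; rewrite ?setCT ?cards0 //; right.
  - by rewrite card_imset ?cardsT ?card_ord //; apply: rim_inj.
  - by have := generator_card hn genS; lia.
have i0 : 'I_n by apply: Ordinal (ltnW n_gt1).
apply: (@edim_eq _ (rim @: [set~ i0])) => [||S genS].
- by apply: rim_set_generator; rewrite ?setCK ?cards1 //; left; lia.
- by rewrite card_imset ?cardsC1 ?card_ord //; apply: rim_inj.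
- by have := generator_card hn genS; lia.
Qed.
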